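(* Let $X_1,X_2$ be normed real vector spaces and $B:X_1\times X_1\to X_2$ a bilinear map with $\|B(a,\tilde a)\|_{X_2}\le2\|a\|_{X_1}\|\tilde a\|_{X_1}$ for all $a,\tilde a\in X_1$. Equip $X_1\times X_2$ with the group product $(a,r)*_B(\tilde a,\tilde r)=(a+\tilde a,r+\tilde r+B(a,\tilde a))$ and put $\|(a,r)\|=\max(\|a\|_{X_1},\|r\|_{X_2}^{1/2})$. Then the functional $$\|w\|_{\mathrm{sym}}=\max(\|w\|,\|w^{-1}\|)$$ is subadditive, i.e. $\|w*_B\tilde w\|_{\mathrm{sym}}\le\|w\|_{\mathrm{sym}}+\|\tilde w\|_{\mathrm{sym}}$, and $$d(w,\tilde w):=\|w^{-1}*_B\tilde w\|_{\mathrm{sym}}$$ is a left-invariant metric on the group $(X_1\times X_2,*_B)$.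
   Context: Here $w^{-1}$ is the inverse in the group $(X_1\times X_2,*_B)$; left-invariant means $d(v*_Bw,v*_B\tilde w)=d(w,\tilde w)$ for all $v,w,\tilde w$. *)

(* Defs.v *)
From HB Require Import structures.
From mathcomp Require Import all_boot all_order all_algebra.
From mathcomp Require Import sesquilinear reals topology normedtype.

Set Implicit Arguments.
Unset Strict Implicit.
Unset Printing Implicit Defensive.

Import Order.TTheory GRing.Theory Num.Theory.
Import numFieldNormedType.Exports.

Local Open Scope ring_scope.

(* An alias indexed by B, so that the group structure for *_B can be declared
   canonical, one for each B, apart from the structures of the plain product. *)
Definition twisted_prod (R : realType) (X1 X2 : normedModType R)
  (B : {bilinear X1 -> X1 -> X2}) : Type := (X1 * X2)%type.

Section TwistedProduct.
Context (R : realType) (X1 X2 : normedModType R).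
Variable B : {bilinear X1 -> X1 -> X2}.
Local Notation G := (twisted_prod B).

HB.instance Definition _ := Choice.on G.

Definition twisted_mul (v w : G) : G :=
  (v.1 + w.1, v.2 + w.2 + B v.1 w.1).

Definition twisted_one : G := (0, 0).

Definition twisted_inv (w : G) : G := (- w.1, - w.2 + B w.1 w.1).

Lemma twisted_mulA : associative twisted_mul.
Proof.
move=> u v w; rewrite /twisted_mul /= linearDl linearDr !addrA.
congr (_, _); rewrite -!addrA; do 2 congr (_ + _).
by rewrite [RHS]addrCA; congr (_ + _); rewrite addrC -addrA.
Qed.

Lemma twisted_mul1 : left_id twisted_one twisted_mul.
Proof. by case=> a r; rewrite /twisted_mul /= linear0l !add0r addr0. Qed.

Lemma twisted_mulr1 : right_id twisted_one twisted_mul.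
Proof. by case=> a r; rewrite /twisted_mul /= linear0r !addr0. Qed.

Lemma twisted_mulV : left_inverse twisted_one twisted_inv twisted_mul.
Proof.
case=> a r; rewrite /twisted_mul /twisted_inv /= linearNl addNr.
by rewrite addrAC addrK addNr.
Qed.

Lemma twisted_mulrV : right_inverse twisted_one twisted_inv twisted_mul.
Proof.
case=> a r; rewrite /twisted_mul /twisted_inv /= linearNr addrN.
by rewrite addrA addrN add0r addrN.
Qed.

HB.instance Definition _ := isGroup.Build G
  twisted_mulA twisted_mul1 twisted_mulr1 twisted_mulV twisted_mulrV.

Definition twisted_norm (w : G) : R := Num.max `|w.1| (Num.sqrt `|w.2|).

Definition sym_norm (w : G) : R :=
  Num.max (twisted_norm w) (twisted_norm w^-1%g).

Definition sym_dist (v w : G) : R := sym_norm (v^-1 * w)%g.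

End TwistedProduct.

(* The library bundles metrics as structures (metricType); this is the
   corresponding predicate on a given distance function. *)
Record is_metric (R : realType) (T : Type) (d : T -> T -> R) : Prop := {
  is_metric_ge0 : forall x y, 0 <= d x y ;
  is_metric_eq0 : forall x y, d x y = 0 <-> x = y ;
  is_metric_sym : forall x y, d x y = d y x ;
  is_metric_triangle : forall x y z, d x z <= d x y + d y z
}.

Definition left_invariant (R : realType) (G : groupType) (d : G -> G -> R) :=
  forall v w w' : G, d (v * w)%g (v * w')%g = d w w'.

(* Main.v *)
Require Import Defs.
From mathcomp Require Import all_boot all_order all_algebra.
From mathcomp Require Import sesquilinear reals topology normedtype.
From mathcomp Require Import ring.
Import Order.TTheory GRing.Theory Num.Theory.
Import numFieldNormedType.Exports.
Local Open Scope ring_scope.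

(** The constant 2 in the bound on B is exactly what makes the homogeneous
    norm subadditive: if (a, r) and (a', r') have norms at most s and t, then
    `|r + r' + B a a'| <= s ^+ 2 + t ^+ 2 + 2 * s * t = (s + t) ^+ 2, so the
    square root of the second component of the product is at most s + t
    ([twisted_normM]). Symmetrizing preserves subadditivity because
    inversion reverses products ([sym_normM]). The symmetrized norm is thus
    a symmetric subadditive function that vanishes only at the identity, and
    any such function N on a group yields the left-invariant metric
    N (v^-1 * w) ([group_norm_metric]). *)

(** The triangle inequality comes from
    x^-1 * z = (x^-1 * y) * (y^-1 * z), and symmetry from
    (x^-1 * y)^-1 = y^-1 * x. *)
Lemma group_norm_metric (R : realType) (G : groupType) (N : G -> R) :
    (forall w, 0 <= N w) -> (forall w, N w = 0 <-> w = 1%g) ->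
    (forall w, N w^-1%g = N w) ->
    (forall v w, N (v * w)%g <= N v + N w) ->
  is_metric (fun v w => N (v^-1 * w)%g).
Proof.
move=> N_ge0 N_eq0 NV NM; split=> [x y|x y|x y|x y z].
- exact: N_ge0.
- rewrite N_eq0; split=> [xy1|->]; last by rewrite mulVg.
  by rewrite -(mulg1 x) -xy1 mulVKg.
- by rewrite -NV invgM invgK.
- by have := NM (x^-1 * y)%g (y^-1 * z)%g; rewrite -mulgA mulVKg.
Qed.

Lemma group_dist_left_invariant (R : realType) (G : groupType) (N : G -> R) :
  left_invariant (fun v w : G => N (v^-1 * w)%g).
Proof. by move=> v w w' /=; rewrite invgM -mulgA mulKg. Qed.

(** Trades the square root for a square, so that subadditivity becomes a
    polynomial estimate. *)
Lemma twisted_norm_le (R : realType) (X1 X2 : normedModType R)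
    (B : {bilinear X1 -> X1 -> X2}) (w : twisted_prod B) (t : R) :
  0 <= t -> (twisted_norm w <= t) = (`|w.1| <= t) && (`|w.2| <= t ^+ 2).
Proof.
move=> t0; rewrite /twisted_norm ge_max -[X in _ && (_ <= X)](ger0_norm t0).
by rewrite -sqrtr_sqr ler_sqrt ?sqr_ge0.
Qed.

Lemma twisted_norm_ge0 (R : realType) (X1 X2 : normedModType R)
    (B : {bilinear X1 -> X1 -> X2}) (w : twisted_prod B) :
  0 <= twisted_norm w.
Proof. by rewrite /twisted_norm le_max normr_ge0. Qed.

Lemma twisted_norm1 (R : realType) (X1 X2 : normedModType R)
    (B : {bilinear X1 -> X1 -> X2}) :
  twisted_norm (1%g : twisted_prod B) = 0.
Proof. by rewrite /twisted_norm /= !normr0 sqrtr0 maxxx. Qed.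

Lemma twisted_norm_eq0 (R : realType) (X1 X2 : normedModType R)
    (B : {bilinear X1 -> X1 -> X2}) (w : twisted_prod B) :
  twisted_norm w <= 0 -> w = 1%g.
Proof.
rewrite twisted_norm_le // expr0n !normr_le0.
by case: w => a r /= /andP[/eqP-> /eqP->].
Qed.

Lemma twisted_normM (R : realType) (X1 X2 : normedModType R)
    (B : {bilinear X1 -> X1 -> X2})
    (hB : forall a a' : X1, `|B a a'| <= 2 * `|a| * `|a'|)
    (v w : twisted_prod B) :
  twisted_norm (v * w)%g <= twisted_norm v + twisted_norm w.
Proof.
have v0 := twisted_norm_ge0 _ _ _ _ v; have w0 := twisted_norm_ge0 _ _ _ _ w.
have := lexx (twisted_norm v); rewrite {1}twisted_norm_le // => /andP[v1 v2].
have := lexx (twisted_norm w); rewrite {1}twisted_norm_le // => /andP[w1 w2].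
rewrite twisted_norm_le ?addr_ge0 //=; apply/andP; split.
  by rewrite (le_trans (ler_normD _ _)) ?lerD.
have -> : (twisted_norm v + twisted_norm w) ^+ 2 = twisted_norm v ^+ 2
    + twisted_norm w ^+ 2 + 2 * twisted_norm v * twisted_norm w by ring.
rewrite (le_trans (ler_normD _ _)) // lerD //.
  by rewrite (le_trans (ler_normD _ _)) ?lerD.
by rewrite (le_trans (hB _ _)) // ler_pM ?mulr_ge0 // ler_wpM2l.
Qed.

Lemma sym_norm_ge0 (R : realType) (X1 X2 : normedModType R)
    (B : {bilinear X1 -> X1 -> X2}) (w : twisted_prod B) :
  0 <= sym_norm w.
Proof. by rewrite /sym_norm le_max twisted_norm_ge0. Qed.

Lemma sym_norm_eq0 (R : realType) (X1 X2 : normedModType R)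
    (B : {bilinear X1 -> X1 -> X2}) (w : twisted_prod B) :
  sym_norm w = 0 <-> w = 1%g.
Proof.
rewrite /sym_norm; split=> [N0|->]; last by rewrite invg1 twisted_norm1 maxxx.
by apply: twisted_norm_eq0; rewrite -N0 le_max lexx.
Qed.

Lemma sym_normV (R : realType) (X1 X2 : normedModType R)
    (B : {bilinear X1 -> X1 -> X2}) (w : twisted_prod B) :
  sym_norm w^-1%g = sym_norm w.
Proof. by rewrite /sym_norm invgK maxC. Qed.

Lemma sym_normM (R : realType) (X1 X2 : normedModType R)
    (B : {bilinear X1 -> X1 -> X2})
    (hB : forall a a' : X1, `|B a a'| <= 2 * `|a| * `|a'|)
    (v w : twisted_prod B) :
  sym_norm (v * w)%g <= sym_norm v + sym_norm w.
Proof.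
rewrite {1}/sym_norm ge_max invgM [X in _ && (_ <= X)]addrC.
by apply/andP; split; apply: (le_trans (twisted_normM _ _ _ _ hB _ _));
   rewrite lerD // le_max lexx ?orbT.
Qed.

Theorem corollary3p6 (R : realType) (X1 X2 : normedModType R)
    (B : {bilinear X1 -> X1 -> X2})
    (hB : forall a a' : X1, `|B a a'| <= 2 * `|a| * `|a'|) :
  (forall w w' : twisted_prod B,
     sym_norm (w * w')%g <= sym_norm w + sym_norm w') /\
  is_metric (sym_dist (B := B)) /\
  left_invariant (sym_dist (B := B)).
Proof.
split; first exact: sym_normM.
split; last exact: group_dist_left_invariant.
apply: group_norm_metric; [exact: sym_norm_ge0 | exact: sym_norm_eq0
  | exact: sym_normV | exact: sym_normM].
Qed.
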